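(* Let $X$ be a smooth Banach space over $\mathbb{C}$ and let $T\in B(X)$ be such that $T-c(T)I$ is a strongly normal operator on $X$. Then $T$ attains its Crawford number if and only if $c(T)$ is an eigenvalue of $T$.
   Context: $B(X)$ is the space of bounded linear operators on $X$, $S_X=\{x\in X:\|x\|=1\}$, $X^*$ is the space of bounded linear functionals on $X$. $X$ is smooth if every $x\in S_X$ admits a unique $x^*\in S_{X^*}$ with $x^*(x)=1$. The duality mapping $J:X\to X^*$ of a smooth Banach space assigns to each $x$ the unique functional $J(x)$ with $\|J(x)\|=\|x\|$ and $J(x)(x)=\|x\|^2$. For $T\in B(X)$ the transpose $T':X^*\to X^*$ is $(T'f)(x)=f(Tx)$. $T\in B(X)$ is self-adjoint if $T'\circ J=J\circ T$; $T$ is strongly normal if $T=S^2$ for some self-adjoint $S\in B(X)$. The numerical range is $W(T)=\{x^*(Tx):x\in S_X,\ x^*\in S_{X^*},\ x^*(x)=1\}$ (so $W(T)=\{J(x)(Tx):x\in S_X\}$), and the Crawford number is $c(T)=\inf\{|\lambda|:\lambda\in W(T)\}$. $T$ attains its Crawford number if there is $x_0\in S_X$ with $|J(x_0)(Tx_0)|=c(T)$. *)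

(* Defs.v *)
From HB Require Import structures.
From mathcomp Require Import all_boot all_order all_algebra.
From mathcomp Require Import complex.
From mathcomp Require Import boolp classical_sets reals topology normedtype.

Set Implicit Arguments.
Unset Strict Implicit.
Unset Printing Implicit Defensive.

Import Order.TTheory GRing.Theory Num.Theory.
Import numFieldNormedType.Exports.

Local Open Scope classical_set_scope.
Local Open Scope ring_scope.
Local Open Scope complex_scope.

(* The norm of a normed module over R[i] is itself R[i]-valued (with zero
   imaginary part, since it is nonnegative for the order of R[i]); [rnorm x] is
   the same number seen in R, where suprema and infima are available. *)
Definition rnorm (R : realType) (V : normedModType R[i]) (x : V) : R :=
  complex.Re `|x|.

Lemma rnormE (R : realType) (V : normedModType R[i]) (x : V) :
  `|x| = (rnorm x)%:C.
Proof.
rewrite /rnorm; have := normr_ge0 x.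
by case: `|x| => a b; rewrite lecE /= => /andP[/eqP -> _].
Qed.

Definition is_bounded (R : realType) (U V : normedModType R[i]) (f : U -> V) :=
  exists M : R, forall x, rnorm (f x) <= M * rnorm x.

Record bounded_op (R : realType) (U V : normedModType R[i]) := BoundedOp {
  op_linear :> {linear U -> V};
  op_bounded : is_bounded op_linear }.

HB.instance Definition _ (R : realType) (U V : normedModType R[i]) :=
  gen_eqMixin (bounded_op U V).
HB.instance Definition _ (R : realType) (U V : normedModType R[i]) :=
  gen_choiceMixin (bounded_op U V).

Section rnorm_theory.
Variables (R : realType) (V : normedModType R[i]).
Implicit Types x y : V.

Lemma rnorm_ge0 x : 0 <= rnorm x.
Proof. by have := normr_ge0 x; rewrite rnormE lecR. Qed.

Lemma rnorm0 : rnorm (0 : V) = 0.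
Proof. by rewrite /rnorm normr0. Qed.

Lemma ler_rnormD x y : rnorm (x + y) <= rnorm x + rnorm y.
Proof. by have := ler_normD x y; rewrite !rnormE -rmorphD /= lecR. Qed.

Lemma rnormN x : rnorm (- x) = rnorm x.
Proof. by rewrite /rnorm normrN. Qed.

Lemma rnormZ (a : R[i]) x : rnorm (a *: x) = rnorm (a : R[i]^o) * rnorm x.
Proof.
apply: (@complexI R); rewrite rmorphM /= -rnormE normrZ rnormE.
by congr (_ * _); rewrite -rnormE.
Qed.

End rnorm_theory.

Section operators.
Variable R : realType.
Implicit Types U V W : normedModType R[i].

Lemma zero_op_subproof U V : is_bounded (\0 : U -> V).
Proof. by exists 0 => x; rewrite /= rnorm0 mul0r. Qed.

Definition zero_op U V : bounded_op U V :=
  @BoundedOp R U V \0 (@zero_op_subproof U V).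

Lemma comp_op_subproof U V W (g : bounded_op V W) (f : bounded_op U V) :
  is_bounded (g \o f).
Proof.
have [[M fM] [N gN]] := (op_bounded f, op_bounded g).
exists (`|N| * M) => x /=; apply: le_trans (gN _) _.
apply: (@le_trans _ _ (`|N| * rnorm (f x))).
  by rewrite ler_wpM2r ?rnorm_ge0// ler_norm.
by rewrite -mulrA ler_wpM2l.
Qed.

Definition comp_op U V W (g : bounded_op V W) (f : bounded_op U V) :
  bounded_op U W := BoundedOp (comp_op_subproof g f).

Lemma sub_scalar_op_subproof V (T : bounded_op V V) (a : R[i]) :
  is_bounded (T \- a \*: idfun).
Proof.
have [M TM] := op_bounded T; exists (M + rnorm (a : R[i]^o)) => x /=.
by rewrite mulrDl (le_trans (ler_rnormD _ _))// rnormN rnormZ lerD2r.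
Qed.

Definition sub_scalar_op V (T : bounded_op V V) (a : R[i]) : bounded_op V V :=
  BoundedOp (sub_scalar_op_subproof T a).

End operators.

Section dual.
Variables (R : realType) (X : normedModType R[i]).

Definition dual := bounded_op X (R[i]^o : normedModType R[i]).

Definition dual_norm (f : dual) : R :=
  sup [set rnorm (f x) | x in [set x : X | rnorm x <= 1]].

Definition transpose (T : bounded_op X X) (f : dual) : dual := comp_op f T.

Definition smooth := forall x : X, rnorm x = 1 ->
  exists! f : dual, dual_norm f = 1 /\ f x = 1.

(* On a smooth space exactly one functional satisfies the condition below; the
   default value zero_op only matters on spaces that are not smooth. *)
Definition duality_map (x : X) : dual :=
  xget (zero_op X (R[i]^o : normedModType R[i]))
    [set f : dual | dual_norm f = rnorm x /\ f x = (rnorm x ^+ 2)%:C].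

Implicit Type T : bounded_op X X.

Definition self_adjoint T := transpose T \o duality_map = duality_map \o T.

Definition strongly_normal T :=
  exists2 S : bounded_op X X, self_adjoint S & T = comp_op S S.

Definition numerical_range T : set R[i] :=
  [set z | exists x : X, exists f : dual,
    [/\ rnorm x = 1, dual_norm f = 1, f x = 1 & z = f (T x)]].

Definition crawford T : R :=
  inf [set rnorm (z : R[i]^o) | z in numerical_range T].

Definition attains_crawford T := exists x0 : X,
  rnorm x0 = 1 /\ rnorm (duality_map x0 (T x0)) = crawford T.

Definition is_eigenvalue T (a : R[i]) := exists2 x : X, x != 0 & T x = a *: x.

End dual.

(* Main.v *)
Require Import Defs.
From mathcomp Require Import all_boot all_order all_algebra.
From mathcomp Require Import complex.
From mathcomp Require Import boolp classical_sets reals topology normedtype.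

Import Order.TTheory GRing.Theory Num.Theory.

Local Open Scope classical_set_scope.
Local Open Scope ring_scope.
Local Open Scope complex_scope.

(** Write [c] for the Crawford number and [T - c I = S^2] with [S] self-adjoint.
    Moving one factor [S] across the duality map gives
    [J x (S (S x)) = J (S x) (S x) = |S x|^2], so that on the unit sphere
    [J x (T x) = c + |S x|^2]; since [c >= 0], this has modulus [c] exactly when
    [S x = 0], and then [T x = c x + S (S x) = c x]
    ([self_adjoint_sqr], [duality_map_sqr_shift]).
    Conversely, at a unit eigenvector [x] for [c] one gets
    [J x (T x) = c (J x x) = c] ([duality_map_self]). *)

Lemma sup_pMl (R : realType) (r : R) (E : set R) :
  0 < r -> E !=set0 -> has_ubound E ->
  sup [set r * x | x in E] = r * sup E.
Proof.
move=> r0 [x0 Ex0] Eub; apply/eqP; rewrite eq_le; apply/andP; split.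
  apply: ge_sup; first by exists (r * x0), x0.
  by move=> _ [x Ex <-]; rewrite ler_pM2l//; exact: ub_le_sup.
rewrite -ler_pdivlMl//; apply: ge_sup; first by exists x0.
move=> x Ex; rewrite ler_pdivlMl//; apply: ub_le_sup; last by exists x.
by exists (r * sup E) => _ [y Ey <-]; rewrite ler_pM2l//; exact: ub_le_sup.
Qed.

Section duality.
Context {R : realType} {X : normedModType R[i]}.
Implicit Types (f : dual X) (x : X) (r : R).

Lemma rnorm_real r : 0 <= r -> rnorm (r%:C : R[i]^o) = r.
Proof.
by move=> r0; apply: (@complexI R); rewrite -rnormE ger0_norm// lecR.
Qed.

Lemma rnorm_eq0 x : (rnorm x == 0) = (x == 0).
Proof. by rewrite -(inj_eq (@complexI R)) -rnormE normr_eq0. Qed.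

Lemma scale_dual_bounded r f : is_bounded (r%:C \*: f).
Proof.
have [M fM] := op_bounded f; exists (rnorm (r%:C : R[i]^o) * M) => x /=.
by rewrite rnormZ -mulrA ler_wpM2l ?rnorm_ge0.
Qed.

Definition scale_dual r f : dual X := BoundedOp (scale_dual_bounded r f).

Lemma dual_norm_scale r f : 0 < r ->
  dual_norm (scale_dual r f) = r * dual_norm f.
Proof.
move=> r0; rewrite /dual_norm -sup_pMl//.
- congr sup; rewrite image_comp; apply: eq_imagel => x _ /=.
  by rewrite rnormZ rnorm_real// ltW.
- by exists (rnorm (f 0)), 0 => //=; rewrite rnorm0 ler01.
- have [M fM] := op_bounded f; exists `|M| => _ [x /= x1 <-].
  apply: le_trans (fM x) _; rewrite -[leRHS]mulr1.
  apply: le_trans (ler_wpM2l (normr_ge0 _) x1).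
  by rewrite ler_wpM2r ?rnorm_ge0 ?ler_norm.
Qed.

Lemma rnorm_normalize x : x != 0 -> rnorm ((rnorm x)^-1%:C *: x) = 1.
Proof.
move=> x0; rewrite rnormZ rnorm_real ?invr_ge0 ?rnorm_ge0// mulVf//.
by rewrite rnorm_eq0.
Qed.

(** Smoothness only provides norming functionals at unit vectors; at [x != 0]
    the functional sought is [|x|] times the one at [x / |x|]. *)
Lemma duality_map_self x : smooth X -> duality_map x x = (rnorm x ^+ 2)%:C.
Proof.
move=> sX; have [->|x0] := eqVneq x 0; first by rewrite raddf0 rnorm0 expr0n.
suff /(xgetPex (zero_op X _))[] : exists f : dual X,
  dual_norm f = rnorm x /\ f x = (rnorm x ^+ 2)%:C by [].
have r0 : rnorm x != 0 by rewrite rnorm_eq0.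
have rgt0 : 0 < rnorm x by rewrite lt_neqAle eq_sym r0 rnorm_ge0.
have [f [[f1 fx] _]] := sX _ (rnorm_normalize _ x0).
exists (scale_dual (rnorm x) f); split.
  by rewrite dual_norm_scale// f1 mulr1.
have xE : x = (rnorm x)%:C *: ((rnorm x)^-1%:C *: x).
  by rewrite scalerA -rmorphM/= divff// scale1r.
rewrite /= {2}xE linearZ /= fx.
(* Scaling in R[i]^o is multiplication. *)
by rewrite -[X in _ *: X]/(_ * _) -[LHS]/(_ * _) mulr1 expr2 rmorphM.
Qed.

(** The identity [J x (S y) = J (S x) y], which defines self-adjointness, taken
    at [y = S x]. *)
Lemma self_adjoint_sqr (S : bounded_op X X) x : smooth X -> self_adjoint S ->
  duality_map x (S (S x)) = (rnorm (S x) ^+ 2)%:C.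
Proof.
move=> sX /(congr1 (fun F : X -> dual X => F x (S x))) /= ->.
exact: duality_map_self.
Qed.

Lemma duality_map_sqr_shift (S T : bounded_op X X) r x :
  smooth X -> self_adjoint S -> sub_scalar_op T r%:C = comp_op S S ->
  rnorm x = 1 -> duality_map x (T x) = (r + rnorm (S x) ^+ 2)%:C.
Proof.
move=> sX Sadj TS x1.
have -> : T x = r%:C *: x + S (S x).
  have /= <- := congr1 (fun A : bounded_op X X => A x) TS.
  by rewrite addrC subrK.
rewrite linearD linearZ /= duality_map_self// self_adjoint_sqr//.
by rewrite x1 expr1n rmorphD /= -[_ *: _]/(_ * _) mulr1.
Qed.

Lemma crawford_ge0 (T : bounded_op X X) : 0 <= crawford T.
Proof.
rewrite /crawford; set W := [set _ | _ in _].
(* On the zero space W is empty, and inf set0 is 0 by convention. *)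
have [W0|/set0P/negP/negPn/eqP ->] := pselect (W !=set0); last by rewrite inf0.
by apply: lb_le_inf => // _ [z _ <-]; exact: rnorm_ge0.
Qed.

End duality.

Theorem proposition6 (R : realType) (X : completeNormedModType R[i])
    (T : bounded_op X X) :
  smooth X ->
  strongly_normal (sub_scalar_op T (crawford T)%:C) ->
  (attains_crawford T <-> is_eigenvalue T (crawford T)%:C).
Proof.
move=> sX [S Sadj TS]; have c0 := crawford_ge0 T; split.
  move=> [x [x1 xc]]; exists x; first by rewrite -rnorm_eq0 x1 oner_eq0.
  have Sx : S x = 0.
    move: xc; rewrite (duality_map_sqr_shift _ _ _ _ sX Sadj TS x1).
    rewrite rnorm_real ?addr_ge0 ?sqr_ge0// => /eqP.
    by rewrite -subr_eq0 addrC addKr sqrf_eq0 rnorm_eq0 => /eqP.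
  have /= := congr1 (fun A : bounded_op X X => A x) TS.
  by rewrite Sx raddf0 => /eqP; rewrite subr_eq0 => /eqP.
move=> [x x0 Tx]; have u1 := rnorm_normalize _ x0.
exists ((rnorm x)^-1%:C *: x); split=> //.
set u := _ *: x in u1 *.
have -> : T u = (crawford T)%:C *: u by rewrite /u linearZ /= Tx !scalerA mulrC.
rewrite linearZ /= duality_map_self// u1 expr1n -[_ *: _]/(_ * _) mulr1.
exact: rnorm_real.
Qed.
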